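(* Let $A$ be a finite subset of a group $G_0$, and let $G=\langle A^{-1}A\rangle$ be the subgroup of $G_0$ generated by $A^{-1}A$. Assume that $|A^{-1}A|\le 2|A|-2$ and $A^{-1}A\neq G$. Then there are an element $a\in A$ and a non-null subgroup $H$ of $G$ (that is, $H\neq\{1\}$) such that one of the following holds: (i) for all $(x,y)\in (A\times A)\setminus (Ha\times Ha)$ one has $x^{-1}Hy\subset A^{-1}A$, and moreover $|A^{-1}A|>|A^{-1}H|+|HA|-2|H|$; (ii) for all $(x,y)\in (A\times A)\setminus (aH\times aH)$ one has $xHy^{-1}\subset AA^{-1}$, and moreover $|AA^{-1}|>|AH|+|AH|-2|H|$.
   Context: For subsets $X,Y$ of a group, $XY=\{xy : x\in X,\ y\in Y\}$ is the Minkowski product and $X^{-1}=\{x^{-1}: x\in X\}$. *)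

(* Defs.v *)
From mathcomp Require Import all_boot finmap.
From mathcomp Require Import boolp classical_sets.

Set Implicit Arguments.
Unset Strict Implicit.
Unset Printing Implicit Defensive.

Local Open Scope fset_scope.
Local Open Scope classical_set_scope.

Definition mulfs (gT : groupType) (X Y : {fset gT}) : {fset gT} :=
  [fset (x * y)%g | x in X, y in Y].

Definition invfs (gT : groupType) (X : {fset gT}) : {fset gT} :=
  [fset (x^-1)%g | x in X].

Notation "X ** Y" := (mulfs X Y) (at level 40, left associativity).
Notation "X ^-1s" := (invfs X) (at level 1, left associativity, format "X ^-1s").

(* group_closed asks for 1 and closure under (x, y) |-> x * y^-1. *)
Definition is_subgroup (gT : groupType) (K : set gT) : Prop :=
  group_closed (mem K).

Definition generated (gT : groupType) (X : set gT) : set gT :=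
  smallest (@is_subgroup gT) X.

(* Main.v *)
(* Alternative (ii) always holds.

   Put E = A^-1 A and call a finite set C a clique if C^-1 C is contained in E;
   left translates of cliques are cliques. The heart of the matter is that
   |E| <= 2|A| - 2 yields a finite subgroup F with |A F| <= |A| + |F| - 2. If A
   is a clique of maximum size, this is Hajnal's inequality (the union and the
   intersection of a family of maximum cliques have total size at least twice
   the clique number) for the translates x^-1 A, whose intersection is the right
   stabilizer of A. In general, let w be the clique number. A subgroup F and a
   symmetric F-invariant set U of E with |U| + |F| >= 2w exist by Hajnal's
   inequality for a maximum clique; take F minimal. If x^-1 y is not in U for
   some x, y in A, take a largest clique C with such a pair and repeat Hajnal's
   exchange argument inside the cosets of F: it produces F' in F and U'
   containing U with |U'| + |F'| >= 2w - (w - |C|), against the minimality of F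
   when |C| = w, and otherwise against the fact that |F'| divides both w and |C|.
   Hence A u A F is a clique, of size at most w.

   Now let H be a subgroup of G minimizing |A H| - |H|, as in Hamidoune's
   isoperimetric method. Then |A H \ A| <= |H| - 2, and a pigeonhole argument in
   the left cosets of H gives the inclusion in (ii), with a chosen so that aH
   has the most elements outside A. Together with the minimality of H, applied to
   H A^-1, this gives the inequality. *)

Require Import Defs.
From mathcomp Require Import all_boot finmap zify.
From mathcomp Require Import boolp classical_sets.

Set Implicit Arguments.
Unset Strict Implicit.
Unset Printing Implicit Defensive.

Local Open Scope fset_scope.

(** * Extremal choices, translates, products and finite subgroups *)

Lemma exists_argmin (T : Type) (P : T -> Prop) (f : T -> nat) (x0 : T) :
  P x0 -> exists x, P x /\ forall y, P y -> (f x <= f y)%N.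
Proof.
have [n] := ubnP (f x0); elim: n x0 => // n IHn x0 ltfn Px0.
have [[y [Py ltyx]]|noy] := pselect (exists y, P y /\ (f y < f x0)%N).
  by apply: (IHn y) => //; exact: leq_trans ltyx _.
exists x0; split=> // y Py; rewrite leqNgt; apply/negP => ltyx.
by apply: noy; exists y.
Qed.

Lemma exists_argmax (T : Type) (P : T -> Prop) (f : T -> nat) (m : nat)
    (x0 : T) :
  (forall x, P x -> (f x <= m)%N) -> P x0 ->
  exists x, P x /\ forall y, P y -> (f y <= f x)%N.
Proof.
move=> lefm Px0.
have [x [Px minx]] := exists_argmin (fun x => m - f x)%N Px0.
by exists x; split=> // y Py; have := minx y Py; have := lefm y Py;
   have := lefm x Px; lia.
Qed.

Definition ltransl (gT : groupType) (x : gT) (X : {fset gT}) : {fset gT} :=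
  [fset (x * y)%g | y in X].

Lemma in_ltransl (gT : groupType) (x y : gT) (X : {fset gT}) :
  (y \in ltransl x X) = ((x^-1 * y)%g \in X).
Proof.
apply/imfsetP/idP => [[z zX ->]|yX]; first by rewrite mulKg.
by exists (x^-1 * y)%g; rewrite // mulVKg.
Qed.

Lemma card_ltransl (gT : groupType) (x : gT) (X : {fset gT}) :
  #|` ltransl x X| = #|` X|.
Proof. by rewrite card_imfset //; exact: mulgI. Qed.

Lemma in_mulfs (gT : groupType) (X Y : {fset gT}) (z : gT) :
  reflect (exists x y, [/\ x \in X, y \in Y & z = (x * y)%g]) (z \in X ** Y).
Proof.
apply: (iffP idP) => [/imfset2P[x xX [y yY ->]]|[x [y [xX yY ->]]]].
  by exists x, y.
by apply/imfset2P; exists x => //; exists y.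
Qed.

Lemma mem_mulfs (gT : groupType) (X Y : {fset gT}) (x y : gT) :
  x \in X -> y \in Y -> (x * y)%g \in X ** Y.
Proof. by move=> xX yY; apply/in_mulfs; exists x, y. Qed.

Lemma in_invfs (gT : groupType) (X : {fset gT}) (x : gT) :
  (x \in X^-1s) = ((x^-1)%g \in X).
Proof.
apply/imfsetP/idP => [[y yX ->]|xX]; first by rewrite invgK.
by exists (x^-1)%g; rewrite // invgK.
Qed.

Definition fsubgroup (gT : groupType) (F : {fset gT}) : Prop :=
  1%g \in F /\ forall x y, x \in F -> y \in F -> (x * y^-1)%g \in F.

Lemma fsubgroupP (gT : groupType) (F : {fset gT}) :
  fsubgroup F <-> is_subgroup [set` F]%classic.
Proof.
split=> [[F1 FV]|[F1 FV]].
  split; first by apply/mem_set.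
  by move=> x y /set_mem xF /set_mem yF; apply/mem_set; exact: FV.
split; first exact: (set_mem F1).
by move=> x y xF yF; apply: set_mem (FV x y _ _); apply/mem_set.
Qed.

Lemma fsubgroupV (gT : groupType) (F : {fset gT}) (x : gT) :
  fsubgroup F -> x \in F -> (x^-1)%g \in F.
Proof. by case=> F1 FV xF; rewrite -[(x^-1)%g]mul1g; exact: FV. Qed.

Lemma fsubgroupM (gT : groupType) (F : {fset gT}) (x y : gT) :
  fsubgroup F -> x \in F -> y \in F -> (x * y)%g \in F.
Proof.
by move=> gF xF yF; rewrite -[y]invgK; apply: gF.2 => //; exact: fsubgroupV.
Qed.

Lemma card_fsubgroup_gt0 (gT : groupType) (F : {fset gT}) :
  fsubgroup F -> (0 < #|` F|)%N.
Proof. by case=> F1 _; rewrite cardfs_gt0; apply/fset0Pn; exists 1%g. Qed.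

(** Such an [X] is a disjoint union of left cosets [x F]; the induction removes one coset at a
    time. *)
Lemma dvdn_card_rstable (gT : groupType) (F X : {fset gT}) :
  fsubgroup F -> (forall x f, x \in X -> f \in F -> (x * f)%g \in X) ->
  (#|` F| %| #|` X|)%N.
Proof.
move=> gF; have [n] := ubnP #|` X|; elim: n X => // n IHn X leXn XF.
have [->|[x xX]] := fset_0Vmem X; first by rewrite cardfs0 dvdn0.
have sxF : ltransl x F `<=` X.
  by apply/fsubsetP => y; rewrite in_ltransl => /(XF x _ xX); rewrite mulVKg.
have := cardfsID (ltransl x F) X; rewrite (fsetIidPr sxF) card_ltransl => <-.
rewrite dvdn_addr //; apply: IHn.
  have := cardfsID (ltransl x F) X; rewrite (fsetIidPr sxF) card_ltransl.
  by have := card_fsubgroup_gt0 gF; lia.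
move=> y f; rewrite !inE !in_ltransl => /andP[yF yX] fF; rewrite XF // andbT.
apply: contra yF => xyf; rewrite -[y](mulgK f) mulgA.
by apply: gF.2 => //; rewrite -mulgA.
Qed.

(** * Cliques, and intersections and unions of their translates *)

Definition clique (gT : groupType) (E C : {fset gT}) : Prop :=
  forall x y, x \in C -> y \in C -> (x^-1 * y)%g \in E.

Lemma clique_sub_ltransl (gT : groupType) (E C : {fset gT}) (x : gT) :
  clique E C -> x \in C -> ltransl (x^-1)%g C `<=` E.
Proof.
move=> cC xC; apply/fsubsetP => y; rewrite in_ltransl invgK => xyC.
by rewrite -(mulKg x y); exact: cC.
Qed.

Lemma card_clique (gT : groupType) (E C : {fset gT}) :
  clique E C -> (#|` C| <= #|` E|)%N.
Proof.
move=> cC; have [->|[x xC]] := fset_0Vmem C; first by rewrite cardfs0.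
by rewrite -(card_ltransl x^-1%g); apply/fsubset_leq_card/clique_sub_ltransl.
Qed.

Lemma clique_ltransl (gT : groupType) (E C : {fset gT}) (x : gT) :
  clique E C -> clique E (ltransl x C).
Proof.
move=> cC y z; rewrite !in_ltransl => yC zC.
by have := cC _ _ yC zC; rewrite invgM invgK -mulgA mulVKg.
Qed.

Lemma in_ltranslV (gT : groupType) (x y : gT) (C : {fset gT}) :
  (y \in ltransl x^-1%g C) = ((x * y)%g \in C).
Proof. by rewrite in_ltransl invgK. Qed.

(** This is the intersection of the translates [x^-1 C] for [x] in [D], cut down to [F]; [row_join]
    is their union, cut down to [S]. The ambient sets keep both finite even for empty [D]. *)
Definition row_meet (gT : groupType) (C F D : {fset gT}) : {fset gT} :=
  [fset y in F | all (fun x => (x * y)%g \in C) D].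

Definition row_join (gT : groupType) (C S D : {fset gT}) : {fset gT} :=
  [fset y in S | has (fun x => (x * y)%g \in C) D].

Lemma row_meetP (gT : groupType) (C F D : {fset gT}) (y : gT) :
  reflect (y \in F /\ forall x, x \in D -> (x * y)%g \in C)
    (y \in row_meet C F D).
Proof.
rewrite !inE /=; apply: (iffP andP) => -[yF yD]; split=> //.
  by move=> x xD; exact: (allP yD).
by apply/allP => x; exact: yD.
Qed.

Lemma row_joinP (gT : groupType) (C S D : {fset gT}) (y : gT) :
  reflect (y \in S /\ exists2 x, x \in D & (x * y)%g \in C)
    (y \in row_join C S D).
Proof.
rewrite !inE /=; apply: (iffP andP) => -[yS yD]; split=> //.
  by have [x xD xyC] := hasP yD; exists x.
by case: yD => x xD xyC; apply/hasP; exists x.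
Qed.

Lemma row_meetU1 (gT : groupType) (C F D : {fset gT}) (z : gT) :
  row_meet C F (z |` D) = row_meet C F D `&` ltransl z^-1%g C.
Proof.
apply/fsetP => y; rewrite in_fsetI in_ltranslV; apply/row_meetP/andP.
  move=> [yF yD]; split; last by apply: yD; rewrite !inE eqxx.
  by apply/row_meetP; split=> // x xD; apply: yD; rewrite !inE xD orbT.
move=> [/row_meetP[yF yD] zyC]; split=> // x; rewrite !inE.
by case/orP => [/eqP->//|]; exact: yD.
Qed.

Lemma row_joinU1 (gT : groupType) (C S D : {fset gT}) (z : gT) :
  row_join C S (z |` D) = row_join C S D `|` (ltransl z^-1%g C `&` S).
Proof.
apply/fsetP => y; rewrite in_fsetU in_fsetI in_ltranslV.
apply/idP/orP => [/row_joinP[yS [x]]|].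
  rewrite in_fset1U => /orP[/eqP-> zyC|xD xyC]; first by right; rewrite zyC.
  by left; apply/row_joinP; split=> //; exists x.
move=> [/row_joinP[yS [x xD xyC]]|/andP[zyC yS]]; apply/row_joinP; split=> //.
  by exists x; rewrite // !inE xD orbT.
by exists z; rewrite // !inE eqxx.
Qed.

(** * Exchange of cliques *)

(** By the symmetry of [E], only products [y^-1 w] across the two pieces need a separate
    hypothesis. *)
Lemma clique_exchange (gT : groupType) (E R Y W : {fset gT}) :
  (forall e, e \in E -> (e^-1)%g \in E) -> clique E R -> clique E Y ->
  (forall y w, y \in Y -> w \in R -> w \in W -> (y^-1 * w)%g \in E) ->
  clique E (Y `|` (R `&` W)).
Proof.
move=> EV cR cY cYW x y; rewrite !inE.
move=> /orP[xY|/andP[xR xW]] /orP[yY|/andP[yR yW]].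
- exact: cY.
- exact: cYW.
- by rewrite -(invgK (x^-1 * y)%g) invgM invgK; apply/EV/cYW.
- exact: cR.
Qed.

(** Inclusion-exclusion for [Y] and [R & W], whose intersection is [Y & R] because [Y] lies in
    [W]. *)
Lemma card_exchange (T : choiceType) (Y R W : {fset T}) :
  Y `<=` W ->
  (#|` Y `|` (R `&` W)| + #|` Y `&` R| + #|` R `\` W| = #|` Y| + #|` R|)%N.
Proof.
move=> sYW; have := cardfsUI Y (R `&` W); have := cardfsID W R.
by rewrite fsetIA fsetIAC (fsetIidPl sYW); lia.
Qed.

(** Adding [z] replaces the meet [Y] by [Y & R] with [R = z^-1 C], and the join gains at least
    [R - W]. As the exchanged set has at most [|C| = |R|] elements, [card_exchange] shows that the
    gain covers the loss. *)
Lemma rank_grow (gT : groupType) (C F S D W : {fset gT}) (z : gT) :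
  row_meet C F D `<=` W ->
  ltransl z^-1%g C `\` W `<=` S `\` row_join C S D ->
  (#|` row_meet C F D `|` (ltransl z^-1%g C `&` W)| <= #|` C|)%N ->
  (#|` row_meet C F D| + #|` row_join C S D|
    <= #|` row_meet C F (z |` D)| + #|` row_join C S (z |` D)|)%N.
Proof.
rewrite row_meetU1 row_joinU1 -(card_ltransl z^-1%g C).
set R := ltransl _ _; set Y := row_meet _ _ _; set P := row_join _ _ _.
move=> sYW sRW leK.
have leP : (#|` P| + #|` R `\` W| <= #|` P `|` (R `&` S)|)%N.
  have sR : R `\` W `<=` (P `|` (R `&` S)) `\` P.
    apply/fsubsetP => y yR; have := fsubsetP sRW y yR.
    move: yR; rewrite !inE => /andP[_ ->] /andP[->->].
    by rewrite orbT.
  have := fsubset_leq_card sR.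
  have := cardfsID P (P `|` (R `&` S)).
  by rewrite (fsetIidPr (fsubsetUl _ _)); lia.
by have := card_exchange R sYW; lia.
Qed.

Lemma exists_maximal_fset (T : choiceType) (V : {fset T}) (x0 : T)
    (P : {fset T} -> Prop) :
  x0 \in V -> P [fset x0] ->
  exists D, [/\ D `<=` V, x0 \in D, P D
    & forall z, z \in V -> z \notin D -> ~ P (z |` D)].
Proof.
move=> x0V P0.
pose Q D := [/\ D `<=` V, x0 \in D & P D].
have leQ D : Q D -> (#|` D| <= #|` V|)%N.
  by case=> sDV _ _; exact: fsubset_leq_card.
have [|D [[sDV x0D PD] maxD]] := exists_argmax (x0 := [fset x0]) leQ.
  by split; rewrite ?fsub1set ?inE.
exists D; split=> // z zV zND Pz.
suff /maxD : Q (z |` D) by rewrite cardfsU1 zND add1n ltnn.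
split=> //; last by rewrite in_fset1U x0D orbT.
by apply/fsubsetP => y; rewrite in_fset1U => /orP[/eqP->//|]; exact: fsubsetP.
Qed.

Lemma row_meet1 (gT : groupType) (E B : {fset gT}) (x : gT) :
  clique E B -> x \in B -> row_meet B E [fset x] = ltransl x^-1%g B.
Proof.
move=> cB xB; apply/fsetP => y; rewrite in_ltranslV; apply/idP/idP.
  by move=> /row_meetP[_ yB]; apply: yB; rewrite inE.
move=> xyB; apply/row_meetP; split; first by rewrite -(mulKg x y); exact: cB.
by move=> z; rewrite inE => /eqP->.
Qed.

Lemma row_join1 (gT : groupType) (E B : {fset gT}) (x : gT) :
  clique E B -> x \in B -> row_join B E [fset x] = ltransl x^-1%g B.
Proof.
move=> cB xB; apply/fsetP => y; rewrite in_ltranslV; apply/idP/idP.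
  by move=> /row_joinP[_ [z]]; rewrite inE => /eqP->.
move=> xyB; apply/row_joinP; split; first by rewrite -(mulKg x y); exact: cB.
by exists x; rewrite ?inE.
Qed.

(* Hajnal's inequality for a family of maximum cliques, here the translates
   [x^-1 B] with [x] in [B]. *)
Lemma hajnal (gT : groupType) (E B : {fset gT}) (x0 : gT) :
  (forall e, e \in E -> (e^-1)%g \in E) -> x0 \in B -> clique E B ->
  (forall C, clique E C -> (#|` C| <= #|` B|)%N) ->
  (2 * #|` B| <= #|` row_meet B E B| + #|` row_join B E B|)%N.
Proof.
move=> EV x0B cB maxB.
pose P D := (2 * #|` B| <= #|` row_meet B E D| + #|` row_join B E D|)%N.
have P0 : P [fset x0].
  by rewrite /P row_meet1 // row_join1 // card_ltransl; lia.
have [D [sDB x0D PD maxD]] := exists_maximal_fset (P := P) x0B P0.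
suff sBD : B `<=` D.
  by have /eqP eDB : D == B; [rewrite eqEfsubset sDB | move: PD; rewrite eDB].
apply/fsubsetP => z zB; apply/negPn/negP => zND; apply: (maxD z zB zND).
(* With [W] the current join, all of [z^-1 B] outside [W] is new; the exchanged set is a clique, so
   its size is at most [|B|]. *)
apply: leq_trans PD _; apply: (@rank_grow _ _ _ _ _ (row_join B E D)).
- apply/fsubsetP => y /row_meetP[yE yD]; apply/row_joinP; split=> //.
  by exists x0 => //; exact: yD.
- by apply: fsetSD; exact: clique_sub_ltransl.
apply/maxB/clique_exchange => //.
- exact: clique_ltransl.
- move=> y y' /row_meetP[_ yD] /row_meetP[_ y'D].
  by rewrite -(mulKg x0 y') mulgA -invgM; apply: cB; [exact: yD|exact: y'D].
move=> y w /row_meetP[_ yD] _ /row_joinP[_ [x xD xwB]].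
by rewrite -(mulKg x w) mulgA -invgM; apply: cB => //; exact: yD.
Qed.

(** * Convergents *)

(* The analogue of the convergents in Kneser's theorem; the lower bound on
   [|U| + |F|] is kept as a separate hypothesis. *)
Definition convergent (gT : groupType) (E U F : {fset gT}) : Prop :=
  [/\ fsubgroup F, 1%g \in U, U `<=` E,
      forall u, u \in U -> (u^-1)%g \in U
    & forall f u, f \in F -> u \in U -> (f * u)%g \in U].

Lemma convergent_sub (gT : groupType) (E U F : {fset gT}) :
  convergent E U F -> F `<=` U.
Proof.
case=> _ U1 _ _ FU; apply/fsubsetP => f fF.
by rewrite -[f]mulg1; exact: FU.
Qed.

Lemma convergentMl (gT : groupType) (E U F : {fset gT}) (f u : gT) :
  convergent E U F -> f \in F -> ((f * u)%g \in U) = (u \in U).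
Proof.
case=> gF _ _ _ FU fF; apply/idP/idP => [fuU|]; last exact: FU.
by rewrite -(mulKg f u); apply: FU => //; exact: fsubgroupV.
Qed.

Lemma convergentV (gT : groupType) (E U F : {fset gT}) (u : gT) :
  convergent E U F -> ((u^-1)%g \in U) = (u \in U).
Proof.
case=> _ _ _ UV _; apply/idP/idP => [/UV|]; last exact: UV.
by rewrite invgK.
Qed.

Lemma convergentMr (gT : groupType) (E U F : {fset gT}) (f u : gT) :
  convergent E U F -> f \in F -> ((u * f)%g \in U) = (u \in U).
Proof.
move=> cU fF; have [gF _ _ _ _] := cU.
rewrite -(convergentV (u * f)%g cU) invgM (convergentMl _ cU).
  exact: (convergentV _ cU).
exact: fsubgroupV.
Qed.

(* Vertices of [C] with a partner that [U] does not account for. *)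
Definition bad (gT : groupType) (U C : {fset gT}) : {fset gT} :=
  [fset x in C | has (fun y => (x^-1 * y)%g \notin U) C].

Lemma badP (gT : groupType) (U C : {fset gT}) (x : gT) :
  reflect (x \in C /\ exists2 y, y \in C & (x^-1 * y)%g \notin U)
    (x \in bad U C).
Proof.
rewrite !inE /=; apply: (iffP andP) => -[xC xy]; split=> //.
  by have [y yC xyU] := hasP xy; exists y.
by case: xy => y yC xyU; apply/hasP; exists y.
Qed.

Lemma bad_sym (gT : groupType) (E U F C : {fset gT}) (x y : gT) :
  convergent E U F -> x \in C -> y \in C -> (x^-1 * y)%g \notin U ->
  y \in bad U C.
Proof.
move=> cU xC yC xyU; apply/badP; split=> //; exists x => //.
by rewrite -(convergentV (y^-1 * x)%g cU) invgM invgK.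
Qed.

(** The set [F] together with [x^-1 C & U] is a clique, hence of size at most [w]; [card_exchange]
    with [Y = F] and [W = U] then yields the bound. *)
Lemma start_rank (gT : groupType) (E U F C : {fset gT}) (w : nat) (x : gT) :
  (forall e, e \in E -> (e^-1)%g \in E) -> convergent E U F ->
  (forall K, clique E K -> (#|` K| <= w)%N) -> clique E C -> x \in C ->
  (#|` F| + #|` C| <=
     #|` row_meet C F [fset x]| + #|` row_join C (E `\` U) [fset x]| + w)%N.
Proof.
move=> EV cU maxw cC xC; have [gF _ sUE _ _] := cU.
have sFU := convergent_sub cU.
have cK : clique E (F `|` (ltransl x^-1%g C `&` U)).
  apply: clique_exchange => //; first exact: clique_ltransl.
    move=> y z yF zF; apply/(fsubsetP sUE)/(fsubsetP sFU).
    by apply: fsubgroupM => //; exact: fsubgroupV.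
  move=> y u yF _ uU; apply: (fsubsetP sUE).
  by rewrite (convergentMl _ cU) //; exact: fsubgroupV.
have := card_exchange (ltransl x^-1%g C) sFU; rewrite card_ltransl.
have -> : F `&` ltransl x^-1%g C = row_meet C F [fset x].
  apply/fsetP => y; rewrite in_fsetI in_ltranslV; apply/andP/row_meetP.
    by case=> yF xyC; split=> // z; rewrite inE => /eqP->.
  by case=> yF yC; split=> //; apply: yC; rewrite inE.
have -> : ltransl x^-1%g C `\` U = row_join C (E `\` U) [fset x].
  apply/fsetP => y; rewrite in_fsetD in_ltranslV; apply/andP/row_joinP.
    case=> yU xyC; split; last by exists x; rewrite ?inE.
    by rewrite in_fsetD yU -(mulKg x y) cC.
  by rewrite in_fsetD => -[/andP[yU _] [z]]; rewrite inE => /eqP->.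
by have := maxw _ cK; lia.
Qed.

Lemma row_meetS (gT : groupType) (C F D D' : {fset gT}) :
  D `<=` D' -> row_meet C F D' `<=` row_meet C F D.
Proof.
move=> sD; apply/fsubsetP => y /row_meetP[yF yD']; apply/row_meetP; split=> //.
by move=> x xD; apply/yD'/(fsubsetP sD).
Qed.

Lemma row_joinS (gT : groupType) (C S D D' : {fset gT}) :
  D `<=` D' -> row_join C S D `<=` row_join C S D'.
Proof.
move=> sD; apply/fsubsetP => y /row_joinP[yS [x xD xyC]].
by apply/row_joinP; split=> //; exists x => //; exact: (fsubsetP sD).
Qed.

(** Left translation by [x^-1 a] sends [a^-1 C & F] into [x^-1 C], and outside [U] since [U] is also
    right [F]-invariant. *)
Lemma card_row_meet_le (gT : groupType) (E U F C : {fset gT}) (x a : gT) :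
  convergent E U F -> clique E C -> x \in C -> a \in C ->
  (x^-1 * a)%g \notin U ->
  (#|` row_meet C F [fset a]| <= #|` row_join C (E `\` U) [fset x]|)%N.
Proof.
move=> cU cC xC aC xaU; rewrite -(card_ltransl (x^-1 * a)%g).
apply/fsubset_leq_card/fsubsetP => y; rewrite in_ltransl.
move=> /row_meetP[]; set f := (_ * y)%g => fF /(_ a); rewrite inE eqxx.
have -> : y = (x^-1 * a * f)%g by rewrite mulVKg.
move=> /(_ isT) afC; apply/row_joinP; split; last first.
  by exists x; rewrite ?inE // mulgA mulVKg.
by rewrite in_fsetD (convergentMr _ cU) // xaU -mulgA cC.
Qed.

(* Elements are added to [D] as long as the exchanged clique keeps a bad pair,
   so that its size is at most [|C|]; a counting argument in [E `\` U] shows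
   that this never stops before [D] is all of [bad U C]. *)
Lemma full_rank (gT : groupType) (E U F C : {fset gT}) (w : nat) :
  (forall e, e \in E -> (e^-1)%g \in E) -> convergent E U F ->
  (2 * w <= #|` U| + #|` F|)%N -> (#|` E| + 2 <= 2 * #|` C|)%N ->
  (forall K, clique E K -> (#|` K| <= w)%N) -> clique E C ->
  (forall K, clique E K -> bad U K != fset0 -> (#|` K| <= #|` C|)%N) ->
  bad U C != fset0 ->
  (#|` F| + #|` C| <=
     #|` row_meet C F (bad U C)| + #|` row_join C (E `\` U) (bad U C)| + w)%N.
Proof.
move=> EV cU leUF leEC maxw cC maxC /fset0Pn[x0 x0V].
have [gF U1 sUE _ _] := cU; have sFU := convergent_sub cU.
have leCw := maxw _ cC.
have sVC : bad U C `<=` C by apply/fsubsetP => x /badP[].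
have leS : (#|` E `\` U| + 2 + 2 * w <= #|` F| + 2 * #|` C|)%N.
  by have := cardfsID U E; rewrite (fsetIidPr sUE); lia.
set V := bad U C in x0V sVC *; set S := E `\` U in leS *.
pose P D :=
  (#|` F| + #|` C| <= #|` row_meet C F D| + #|` row_join C S D| + w)%N.
have start x : x \in C -> P [fset x] by exact: start_rank.
have x0C := fsubsetP sVC _ x0V.
have [D [sDV x0D PD maxD]] := exists_maximal_fset (P := P) x0V (start _ x0C).
suff sVD : V `<=` D.
  by have /eqP eDV : D == V; [rewrite eqEfsubset sDV | move: PD; rewrite eDV].
have sDC := fsubset_trans sDV sVC.
apply/fsubsetP => z zV; apply/negPn/negP => zND.
(* If the two joins shared some [e], the exchanged clique would contain 1 and [e], a bad pair as [e]
   is not in [U]. Its size would be at most [|C|], so [y] could be added to [D]. *)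
have disj y : y \in V -> y \notin D ->
    (#|` row_join C S [fset y]| + #|` row_join C S D| <= #|` S|)%N.
  move=> yV yND; have yC := fsubsetP sVC _ yV.
  have sS X : row_join C S X `<=` S by apply/fsubsetP => e /row_joinP[].
  suff I0 : row_join C S [fset y] `&` row_join C S D = fset0.
    have := cardfsUI (row_join C S [fset y]) (row_join C S D).
    rewrite I0 cardfs0 addn0 => <-; apply: fsubset_leq_card.
    by rewrite fsubUset !sS.
  apply/eqP/negPn/negP => /fset0Pn[e]; rewrite in_fsetI => /andP[].
  move=> /row_joinP[eS [y']]; rewrite inE => /eqP-> yeC eD.
  apply: (maxD y yV yND); apply: leq_trans PD _; rewrite leq_add2r.
  apply: (@rank_grow _ _ _ _ _ (U `|` row_join C S D)).
  - apply/fsubsetP => f /row_meetP[fF _].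
    by rewrite in_fsetU (fsubsetP sFU).
  - apply/fsubsetP => u; rewrite !in_fsetD in_fsetU negb_or.
    move=> /andP[/andP[uU uD]]; rewrite uD uU.
    by apply: fsubsetP; exact: clique_sub_ltransl.
  apply: maxC.
    apply: clique_exchange => //; first exact: clique_ltransl.
      move=> f g /row_meetP[fF _] /row_meetP[gF' _].
      apply/(fsubsetP sUE)/(fsubsetP sFU).
      by apply: fsubgroupM => //; exact: fsubgroupV.
    move=> f u /row_meetP[fF fD] _; rewrite in_fsetU => /orP[uU|].
      apply: (fsubsetP sUE); rewrite (convergentMl _ cU) //.
      exact: fsubgroupV.
    move=> /row_joinP[_ [x xD xuC]].
    by rewrite -(mulKg x u) mulgA -invgM; apply: cC => //; exact: fD.
  apply/fset0Pn; exists 1%g; apply/badP; split.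
    by rewrite in_fsetU in_fsetI in_ltranslV mulg1 yC in_fsetU U1 orbT.
  exists e.
    by rewrite in_fsetU in_fsetI in_ltranslV yeC in_fsetU eD !orbT.
  by move: eS; rewrite invg1 mul1g in_fsetD => /andP[].
(* Otherwise [start] at [a] gives [|F| + |C| <= |S| + w], which with [leS] forces [|C| >= w + 2]. *)
have closed x a : x \in D -> a \in C -> (x^-1 * a)%g \notin U -> a \in D.
  move=> xD aC xaU; apply/negPn/negP => aND.
  have xC := fsubsetP sDC _ xD.
  have leaS := disj a (bad_sym cU xC aC xaU) aND.
  have leax := card_row_meet_le cU cC xC aC xaU.
  have lexD : (#|` row_join C S [fset x]| <= #|` row_join C S D|)%N.
    by apply/fsubset_leq_card/row_joinS; rewrite fsub1set.
  have := start _ aC; rewrite /P; move: leaS leax lexD leS leCw; rewrite -/S.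
  by clear; lia.
have [_ [a aC x0aU]] := badP _ _ _ x0V.
have aD := closed _ _ x0D aC x0aU.
have [_ [b bC zbU]] := badP _ _ _ zV.
have zC := fsubsetP sVC _ zV.
have bV := bad_sym cU zC bC zbU.
have bND : b \notin D.
  apply: contra zND => bD; apply: closed bD zC _.
  by rewrite -(convergentV (b^-1 * z)%g cU) invgM invgK.
(* Now [x0, a] is a bad pair inside [D] and [z, b] one outside. Adding [PD] to [start] at [b], and
   bounding each meet by the join of its partner, gives [2|F| + 2|C| <= 2|S| + 2w], the same
   contradiction. *)
have := card_row_meet_le cU cC x0C aC x0aU.
have := card_row_meet_le cU cC zC bC zbU.
have : (#|` row_join C S [fset x0]| <= #|` row_join C S D|)%N.
  by apply/fsubset_leq_card/row_joinS; rewrite fsub1set.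
have : (#|` row_meet C F D| <= #|` row_meet C F [fset a]|)%N.
  by apply/fsubset_leq_card/row_meetS; rewrite fsub1set.
have := disj _ zV zND; have := disj _ bV bND; have := start _ bC.
by move: PD leS leCw; rewrite /P -/S; clear; lia.
Qed.

(** * Stabilizers and minimal convergents *)

Lemma rstableV (gT : groupType) (V : {fset gT}) (f : gT) :
  (forall v, v \in V -> (v * f)%g \in V) ->
  forall v, v \in V -> (v * f^-1)%g \in V.
Proof.
move=> Vf v vV; pose Vf' := [fset (u * f)%g | u in V].
have sVf : Vf' `<=` V by apply/fsubsetP => _ /imfsetP[u uV ->]; exact: Vf.
have cVf : #|` Vf'| = #|` V| by rewrite card_imfset //; exact: mulIg.
have /eqP eVf : Vf' == V by rewrite eqEfcard sVf cVf leqnn.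
by move: vV; rewrite -{1}eVf => /imfsetP[u uV ->]; rewrite mulgK.
Qed.

(** Here the meet is the right stabilizer of [B] and the join is [B^-1 B]. *)
Lemma convergent_clique (gT : groupType) (E B : {fset gT}) (x0 : gT) :
  (forall e, e \in E -> (e^-1)%g \in E) -> x0 \in B -> clique E B ->
  convergent E (row_join B E B) (row_meet B E B).
Proof.
move=> EV x0B cB.
have E1 : 1%g \in E by rewrite -(mulVg x0); exact: cB.
have BV f : f \in row_meet B E B -> forall v, v \in B -> (v * f^-1)%g \in B.
  by move=> /row_meetP[_ fB]; apply: rstableV => v; exact: fB.
split.
- split; first by apply/row_meetP; split=> // x xB; rewrite mulg1.
  move=> f g /row_meetP[fE fB] gF.
  have Bfg x : x \in B -> (x * (f / g))%g \in B.
    by move=> xB; rewrite mulgA; apply: BV => //; exact: fB.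
  apply/row_meetP; split=> //.
  by rewrite -(mulKg x0 (f / g)%g); apply: cB => //; exact: Bfg.
- by apply/row_joinP; split=> //; exists x0; rewrite ?mulg1.
- by apply/fsubsetP => u /row_joinP[].
- move=> u /row_joinP[uE [x xB xuB]]; apply/row_joinP; split; first exact: EV.
  by exists (x * u)%g; rewrite ?mulgK.
move=> f u fF /row_joinP[uE [x xB xuB]]; have xfB := BV _ fF _ xB.
have fuB : ((x * f^-1) * (f * u))%g \in B by rewrite mulgA mulgVK.
apply/row_joinP; split; last by exists (x * f^-1)%g.
by rewrite -(mulKg (x * f^-1)%g (f * u)%g); exact: cB.
Qed.

(** A vertex that is not bad has all its quotients with [K] in [U], and the two-sided [F]-invariance
    of [U] keeps them there after right multiplication by [F]. *)
Lemma good_clique (gT : groupType) (E U F K : {fset gT}) (X : {fset gT}) :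
  convergent E U F -> clique E K -> X `<=` K ->
  (forall x, x \in X -> x \notin bad U K) -> clique E (K `|` (X ** F)).
Proof.
move=> cU cK sXK goodX; have [gF U1 sUE UV _] := cU; have sUEP := fsubsetP sUE.
have good x y : x \in X -> y \in K -> (x^-1 * y)%g \in U.
  move=> xX yK; apply/negPn/negP => xyU; have /negP := goodX _ xX; apply.
  by apply/badP; split; [exact: (fsubsetP sXK) | exists y].
have goodF x f y : x \in X -> f \in F -> y \in K -> ((x * f)^-1 * y)%g \in U.
  move=> xX fF yK; rewrite invgM -mulgA (convergentMl _ cU) ?good //.
  exact: fsubgroupV.
move=> x y; rewrite !in_fsetU.
move=> /orP[xK|/in_mulfs[x' [f [xX fF ->]]]] /orP[yK|].
- exact: cK.
- move=> /in_mulfs[y' [f [yX fF ->]]]; apply: sUEP.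
  by rewrite -(convergentV (x^-1 * (y' * f))%g cU) invgM invgK goodF.
- by apply: sUEP; exact: goodF.
- move=> /in_mulfs[z [g [zX gF' ->]]]; apply: sUEP.
  by rewrite mulgA (convergentMr _ cU) // goodF // (fsubsetP sXK).
Qed.

Lemma no_bad (gT : groupType) (E U F A B : {fset gT}) :
  (forall e, e \in E -> (e^-1)%g \in E) -> convergent E U F ->
  (2 * #|` B| <= #|` U| + #|` F|)%N ->
  (forall U' F', convergent E U' F' -> (2 * #|` B| <= #|` U'| + #|` F'|)%N ->
     (#|` F| <= #|` F'|)%N) ->
  clique E B -> (forall K, clique E K -> (#|` K| <= #|` B|)%N) ->
  clique E A -> (#|` E| + 2 <= 2 * #|` A|)%N -> bad U A = fset0.
Proof.
move=> EV cU leUF minF cB maxB cA leEA; apply/eqP/negPn/negP => badA.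
have [gF U1 sUE UV FU] := cU; have sFU := convergent_sub cU.
have [||C [[cC badC] maxC]] := exists_argmax
    (P := fun K => clique E K /\ bad U K != fset0) (f := fun K => #|` K|)
    (m := #|` B|) (x0 := A).
- by move=> K [cK _]; exact: maxB.
- by [].
have leAC := maxC A (conj cA badA).
have leEC : (#|` E| + 2 <= 2 * #|` C|)%N by lia.
have {}maxC K : clique E K -> bad U K != fset0 -> (#|` K| <= #|` C|)%N.
  by move=> cK badK; exact: maxC.
have := full_rank EV cU leUF leEC maxB cC maxC badC.
set V := bad U C; set S := E `\` U; set F' := row_meet C F V.
set L := row_join C S V => rankV.
have leCB := maxB _ cC.
have leS : (#|` S| + 2 + 2 * #|` B| <= #|` F| + 2 * #|` C|)%N.
  by have := cardfsID U E; rewrite (fsetIidPr sUE) -/S; lia.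
have leL : (#|` L| <= #|` S|)%N.
  by apply/fsubset_leq_card/fsubsetP => e /row_joinP[].
have sF'F : F' `<=` F by apply/fsubsetP => f /row_meetP[].
have VF' f v : f \in F' -> v \in V -> (v * f)%g \in V.
  move=> /row_meetP[fF fV] vV; have [vC [y yC vyU]] := badP _ _ _ vV.
  apply/badP; split; first exact: fV.
  exists y => //; rewrite invgM -mulgA (convergentMl _ cU) //.
  exact: fsubgroupV.
have VF'V f v : f \in F' -> v \in V -> (v * f^-1)%g \in V.
  by move=> fF'; apply: rstableV => u; exact: VF'.
have sVC v : v \in V -> v \in C by case/badP.
have gF' : fsubgroup F'.
  split.
    apply/row_meetP; split; first by case: gF.
    by move=> v; rewrite mulg1; exact: sVC.
  move=> f g fF' gF'; apply/row_meetP; split.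
    by apply: gF.2; exact: (fsubsetP sF'F).
  by move=> v vV; rewrite mulgA; apply/sVC/VF'V => //; exact: VF'.
have F'L f e : f \in F' -> e \in L -> (f * e)%g \in L.
  move=> fF' /row_joinP[eS [v vV veC]]; have fF := fsubsetP sF'F _ fF'.
  have vfV := VF'V _ _ fF' vV.
  have vfe : ((v * f^-1) * (f * e))%g = (v * e)%g by rewrite mulgA mulgVK.
  apply/row_joinP; split; last by exists (v * f^-1)%g; rewrite ?vfe.
  rewrite in_fsetD (convergentMl _ cU) //; move: eS; rewrite in_fsetD.
  case/andP => -> _ /=; rewrite -(mulKg (v * f^-1)%g (f * e)%g) vfe.
  by apply: cC => //; exact: sVC.
(* Substitute [|L| <= |S|] and [leS] into [rankV]; the 2 is the slack in [|E| + 2 <= 2|C|]. *)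
have ltF' : (2 + (#|` B| - #|` C|) <= #|` F'|)%N.
  by move: rankV leS leL leCB; clear; lia.
(* For [x] not bad, adjoining [x F] to [C] keeps both the clique property and the bad pairs, so
   maximality of [C] puts [x F] inside [C]. *)
have CF' x f : x \in C -> f \in F' -> (x * f)%g \in C.
  move=> xC fF'; have [xV|xV] := boolP (x \in V); first exact/sVC/VF'.
  have cK : clique E (C `|` ([fset x] ** F)).
    by apply: good_clique cU cC _ _; [rewrite fsub1set | move=> y /fset1P->].
  have badK : bad U (C `|` ([fset x] ** F)) != fset0.
    have /fset0Pn[v /badP[vC [y yC vyU]]] := badC.
    apply/fset0Pn; exists v; apply/badP; split; first by rewrite in_fsetU vC.
    by exists y => //; rewrite in_fsetU yC.
  have := maxC _ cK badK; have := fsubsetUl C ([fset x] ** F).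
  move=> sCK leKC; have /eqP -> : C == C `|` ([fset x] ** F).
    by rewrite eqEfcard sCK.
  rewrite in_fsetU mem_mulfs ?orbT ?inE //; exact: (fsubsetP sF'F).
(* If [|C| = |B|], the pair [U + L], [F'] is again a convergent of sufficient size, so [F' = F].
   Then [L], nonempty and left [F]-invariant, has at least [|F|] elements, whereas [leS] allows at
   most [|F| - 2]. *)
have [eCB|neCB] := eqVneq #|` C| #|` B|.
  have cU' : convergent E (U `|` L) F'.
    split => //.
    - by rewrite in_fsetU U1.
    - rewrite fsubUset sUE; apply/fsubsetP => e /row_joinP[].
      by rewrite in_fsetD => /andP[].
    - move=> e; rewrite !in_fsetU => /orP[/UV->//|/row_joinP[eS [v vV veC]]].
      have [vC _] := badP _ _ _ vV.
      have /andP[eU eE] : (e \notin U) && (e \in E).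
        by rewrite -in_fsetD.
      apply/orP; right; apply/row_joinP; split.
        by rewrite in_fsetD (convergentV _ cU) eU EV.
      exists (v * e)%g; last by rewrite mulgK.
      by apply: (bad_sym cU vC veC); rewrite mulKg.
    move=> f u fF'; rewrite !in_fsetU => /orP[uU|uL]; last by rewrite F'L ?orbT.
    by rewrite FU // (fsubsetP sF'F).
  have UL0 : U `&` L = fset0.
    apply/eqP/negPn/negP => /fset0Pn[e]; rewrite in_fsetI => /andP[eU].
    by move=> /row_joinP[]; rewrite in_fsetD eU.
  have := cardfsUI U L; rewrite UL0 cardfs0 addn0 => cUL.
  have leFF' : (#|` F| <= #|` F'|)%N.
    by apply: minF cU' _; rewrite cUL; move: rankV leUF eCB; clear; lia.
  have /eqP eF : F' == F by rewrite eqEfcard sF'F.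
  have /fset0Pn[v vV] := badC; have [vC [y yC vyU]] := badP _ _ _ vV.
  have eL : (v^-1 * y)%g \in L.
    apply/row_joinP; split; first by rewrite in_fsetD vyU cC.
    by exists v; rewrite // mulVKg.
  have : (#|` F'| <= #|` L|)%N.
    have <- : #|` [fset (f * (v^-1 * y))%g | f in F']| = #|` F'|.
      by rewrite card_imfset //; exact: mulIg.
    by apply/fsubset_leq_card/fsubsetP => _ /imfsetP[f fF' ->]; exact: F'L.
  by rewrite eF; move: leL leS eCB; clear; lia.
(* If [|C| < |B|], then [B] is too large to have bad pairs, so [F'] stabilizes both [B] and [C].
   Thus [|F'|] divides [|B| - |C| > 0], which is smaller than [|F'|]. *)
have badB : bad U B = fset0.
  apply/eqP/negPn/negP => badB; have := maxC _ cB badB.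
  by move: neCB leCB; clear; lia.
have cBF : clique E (B `|` (B ** F)).
  by apply: good_clique cU cB (fsubset_refl _) _ => x _; rewrite badB inE.
have BF' x f : x \in B -> f \in F' -> (x * f)%g \in B.
  move=> xB fF'; have /eqP -> : B == B `|` (B ** F).
    by rewrite eqEfcard fsubsetUl maxB.
  by rewrite in_fsetU mem_mulfs ?orbT // (fsubsetP sF'F).
have dvB := dvdn_card_rstable gF' BF'.
have dvC := dvdn_card_rstable gF' CF'.
have := dvdn_leq _ (dvdn_sub dvB dvC).
by move: ltF' neCB leCB; clear; lia.
Qed.

(** For a minimal convergent, [A F] lies in a clique, so [|A F| <= |B|]; combine this with
    [2|B| <= |E| + |F|] and [|A| <= |B|]. *)
Lemma small_quotient_stable (gT : groupType) (A : {fset gT}) :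
  (#|` A^-1s ** A| + 2 <= 2 * #|` A|)%N ->
  exists F, [/\ fsubgroup F, F `<=` A^-1s ** A
    & (#|` A ** F| + 2 <= #|` A| + #|` F|)%N].
Proof.
move eE : (A^-1s ** A) => E leE.
have cA : clique E A.
  move=> x y xA yA; rewrite -eE; apply: mem_mulfs => //.
  by rewrite in_invfs invgK.
have EV e : e \in E -> (e^-1)%g \in E.
  rewrite -eE => /in_mulfs[x [y [xA yA ->]]]; rewrite invgM.
  apply: mem_mulfs; first by rewrite in_invfs invgK.
  by rewrite -in_invfs.
have [||B [cB maxB]] := exists_argmax (P := clique E) (f := fun K => #|` K|)
    (m := #|` E|) (x0 := A); [by move=> K; exact: card_clique | by [] |].
have leAB := maxB _ cA.
have /fset0Pn[x0 x0B] : B != fset0 by rewrite -cardfs_gt0; lia.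
have [|[U F] /= [[cU leUF] minF]] := exists_argmin
    (P := fun p => convergent E p.1 p.2 /\
                   (2 * #|` B| <= #|` p.1| + #|` p.2|)%N)
    (fun p => #|` p.2|) (x0 := (row_join B E B, row_meet B E B)).
  split; first exact: convergent_clique x0B cB.
  by rewrite addnC; exact: hajnal x0B cB maxB.
have badA : bad U A = fset0.
  apply: no_bad cU leUF _ cB maxB cA leE => // U' F' cU' leUF'.
  exact: (minF (U', F')).
have [gF _ sUE _ _] := cU; exists F; split => //.
  exact: fsubset_trans (convergent_sub cU) sUE.
have cAF : clique E (A `|` (A ** F)).
  by apply: good_clique cU cA (fsubset_refl _) _ => x _; rewrite badA inE.
have leAF := leq_trans (fsubset_leq_card (fsubsetUr A (A ** F))) (maxB _ cAF).
have leU := fsubset_leq_card sUE.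
move: leAF leU leE leUF leAB.
move: #|` A ** F| #|` U| #|` E| #|` F| #|` A| #|` B| => af u e f a b.
by clear; lia.
Qed.

(** * Atoms *)

Lemma card_mulfs_ge (gT : groupType) (A X : {fset gT}) (a : gT) :
  a \in A -> (#|` X| <= #|` A ** X|)%N.
Proof.
move=> aA; rewrite -(card_ltransl a X); apply/fsubset_leq_card/fsubsetP => y.
by rewrite in_ltransl => ayX; rewrite -(mulVKg a y) mem_mulfs.
Qed.

Lemma card_mulfs1 (gT : groupType) (X : {fset gT}) (x : gT) :
  #|` X ** [fset x]| = #|` X|.
Proof.
have -> : X ** [fset x] = [fset (y * x)%g | y in X].
  apply/fsetP => z; apply/in_mulfs/imfsetP => [[y [w [yX]]]|[y yX ->]].
    by rewrite inE => /eqP-> ->; exists y.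
  by exists y, x; rewrite inE.
by rewrite card_imfset //; exact: mulIg.
Qed.

Lemma mulfsA (gT : groupType) (X Y Z : {fset gT}) :
  X ** (Y ** Z) = X ** Y ** Z.
Proof.
apply/fsetP => w; apply/in_mulfs/in_mulfs.
  move=> [x [_ [xX /in_mulfs[y [z [yY zZ ->]]] ->]]].
  by exists (x * y)%g, z; rewrite mem_mulfs // mulgA.
move=> [_ [z [/in_mulfs[x [y [xX yY ->]]] zZ ->]]].
by exists x, (y * z)%g; rewrite mem_mulfs // mulgA.
Qed.

(** Multiplication by [A] commutes with unions, but sends an intersection only into the intersection
    of the products. *)
Lemma card_mulfs_submod (gT : groupType) (A X Y : {fset gT}) :
  (#|` A ** (X `&` Y)| + #|` A ** (X `|` Y)| <= #|` A ** X| + #|` A ** Y|)%N.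
Proof.
have := cardfsUI (A ** X) (A ** Y).
have -> : A ** (X `|` Y) = (A ** X) `|` (A ** Y).
  apply/fsetP => z; rewrite in_fsetU; apply/idP/orP.
    move=> /in_mulfs[a [x [aA]]]; rewrite in_fsetU => /orP[xX|xY] ->.
      by left; exact: mem_mulfs.
    by right; exact: mem_mulfs.
  by case=> /in_mulfs[a [x [aA xX ->]]]; rewrite mem_mulfs // in_fsetU xX ?orbT.
have : A ** (X `&` Y) `<=` (A ** X) `&` (A ** Y).
  apply/fsubsetP => z /in_mulfs[a [x [aA]]]; rewrite in_fsetI.
  by move=> /andP[xX xY] ->; rewrite in_fsetI !mem_mulfs.
by move=> /fsubset_leq_card; lia.
Qed.

(* [H] is a 1-atom in the sense of Hamidoune's isoperimetric method: a set
   minimizing [|A X| - |X|], of least cardinality, translated to contain 1. *)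
Lemma exists_atom (gT : groupType) (A : {fset gT}) (G : gT -> Prop) (a : gT) :
  a \in A -> G 1%g -> (forall x y, G x -> G y -> G (x * y^-1)%g) ->
  exists H, [/\ fsubgroup H, forall x, x \in H -> G x
    & forall X, X != fset0 -> (forall x, x \in X -> G x) ->
        (#|` A ** H| + #|` X| <= #|` A ** X| + #|` H|)%N].
Proof.
move=> aA G1 GV; have geA X := card_mulfs_ge X aA.
pose inG (X : {fset gT}) := X != fset0 /\ forall x, x \in X -> G x.
pose f X := (#|` A ** X| - #|` X|)%N.
have inG1 : inG [fset 1%g].
  split; first by apply/fset0Pn; exists 1%g; rewrite inE.
  by move=> x; rewrite inE => /eqP->.
have [X0 [inX0 minX0]] := exists_argmin f inG1.
have [X [[inX minX] leX]] := exists_argmin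
  (P := fun X => inG X /\ forall Y, inG Y -> (f X <= f Y)%N)
  (fun X => #|` X|) (conj inX0 minX0).
have [/fset0Pn[x xX] XG] := inX.
pose R y := X ** [fset (y^-1)%g].
have inR y z : (z \in R y) = ((z * y)%g \in X).
  apply/in_mulfs/idP => [[u [v [uX]]]|zyX].
    by rewrite inE => /eqP-> ->; rewrite mulgVK.
  by exists (z * y)%g, (y^-1)%g; rewrite inE mulgK.
have RG y : y \in X -> inG (R y).
  move=> yX; split; first by apply/fset0Pn; exists 1%g; rewrite inR mul1g.
  move=> z; rewrite inR => zyX; rewrite -(mulgK y z); apply: GV; exact: XG.
have cR y : #|` R y| = #|` X| by rewrite card_mulfs1.
have fR y : f (R y) = f X by rewrite /f cR /R mulfsA card_mulfs1.
(* Both translates contain 1, so their intersection and union are admissible. Submodularity makes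
   the intersection a minimizer, and least cardinality makes it equal to both. *)
have eqR y z : y \in X -> z \in X -> R y = R z.
  move=> yX zX.
  have I1 : 1%g \in R y `&` R z by rewrite in_fsetI !inR !mul1g yX.
  have inI : inG (R y `&` R z).
    split; first by apply/fset0Pn; exists 1%g.
    by move=> u; rewrite in_fsetI => /andP[/(RG _ yX).2].
  have inU : inG (R y `|` R z).
    split; first by apply/fset0Pn; exists 1%g; rewrite in_fsetU inR mul1g yX.
    by move=> u; rewrite in_fsetU => /orP[/(RG _ yX).2|/(RG _ zX).2].
  have leI : (f (R y `&` R z) <= f X)%N.
    have := minX _ inU; have := card_mulfs_submod A (R y) (R z).
    have := cardfsUI (R y) (R z); have := fR y; have := fR z.
    have := geA (R y `&` R z); have := geA (R y `|` R z).
    by have := geA (R y); have := geA (R z); rewrite /f; lia.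
  have minI Y : inG Y -> (f (R y `&` R z) <= f Y)%N.
    by move=> inY; apply: leq_trans leI _; exact: minX.
  have leXI := leX _ (conj inI minI).
  have /eqP eIy : R y `&` R z == R y by rewrite eqEfcard fsubsetIl cR.
  have /eqP eIz : R y `&` R z == R z by rewrite eqEfcard fsubsetIr cR.
  by rewrite -eIy {1}eIz.
exists (R x); split.
- split; first by rewrite inR mul1g.
  move=> y z; rewrite [y \in _]inR [z \in _]inR => yxX zxX.
  (* Rewriting [R x] as [R (z x)] turns membership of [y z^-1] into [y x] in [X]. *)
  by rewrite -(eqR _ _ zxX xX) inR mulgA mulgVK.
- exact: (RG _ xX).2.
move=> Y Y0 YG; have := minX _ (conj Y0 YG); rewrite -(fR x).
by have := geA (R x); have := geA Y; rewrite /f; lia.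
Qed.

(** * Left cosets of a finite subgroup and the elements of them that [A] misses *)

Lemma ltransl_eq (gT : groupType) (H : {fset gT}) (x y : gT) :
  fsubgroup H -> (x^-1 * y)%g \in H -> ltransl x H = ltransl y H.
Proof.
move=> gH xyH; apply/fsetP => z; rewrite !in_ltransl; apply/idP/idP => zH.
  have -> : (y^-1 * z)%g = ((x^-1 * y)^-1 * (x^-1 * z))%g.
    by rewrite invgM invgK -mulgA mulVKg.
  by apply: fsubgroupM => //; exact: fsubgroupV.
have -> : (x^-1 * z)%g = ((x^-1 * y) * (y^-1 * z))%g by rewrite -mulgA mulVKg.
exact: fsubgroupM.
Qed.

Lemma ltransl_disjoint (gT : groupType) (H : {fset gT}) (x y : gT) :
  fsubgroup H -> (x^-1 * y)%g \notin H -> ltransl x H `&` ltransl y H = fset0.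
Proof.
move=> gH xyH; apply/eqP/negPn/negP => /fset0Pn[z].
rewrite in_fsetI !in_ltransl => /andP[xzH yzH]; have /negP := xyH; apply.
have -> : (x^-1 * y)%g = ((x^-1 * z) * (y^-1 * z)^-1)%g.
  by rewrite invgM invgK -mulgA mulVKg.
exact: gH.2.
Qed.

(** The two cosets are disjoint and lie in [A H], so their elements missed by [A] are counted
    separately in [A H - A]. *)
Lemma deficit_disjoint (gT : groupType) (A H : {fset gT}) (x y : gT) :
  fsubgroup H -> x \in A -> y \in A -> (x^-1 * y)%g \notin H ->
  (#|` ltransl x H `\` A| + #|` ltransl y H `\` A| + #|` A| <= #|` A ** H|)%N.
Proof.
move=> gH xA yA xyH; have [H1 _] := gH.
have sAH : A `<=` A ** H.
  by apply/fsubsetP => z zA; rewrite -[z]mulg1 mem_mulfs.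
have sH z : z \in A -> ltransl z H `<=` A ** H.
  move=> zA; apply/fsubsetP => u; rewrite in_ltransl => zuH.
  by rewrite -(mulVKg z u) mem_mulfs.
have := cardfsID A (A ** H); rewrite (fsetIidPr sAH).
have := cardfsUI (ltransl x H `\` A) (ltransl y H `\` A).
have -> : (ltransl x H `\` A) `&` (ltransl y H `\` A) = fset0.
  have := ltransl_disjoint gH xyH => /fsetP I0.
  apply/fsetP => z; have := I0 z; rewrite !in_fsetI !in_fsetD in_fset0.
  by case: (z \in A) => //=; rewrite andbF.
rewrite cardfs0 addn0 -fsetDUl => <-.
have : (ltransl x H `|` ltransl y H) `\` A `<=` (A ** H) `\` A.
  by apply: fsetSD; rewrite fsubUset !sH.
by move=> /fsubset_leq_card; lia.
Qed.

(* Pigeonhole: some [k] in [H] has both [x * h * k] and [y * k] in [A]. *)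
Lemma mem_quotient (gT : groupType) (A H : {fset gT}) (x y h : gT) :
  fsubgroup H -> h \in H ->
  (#|` ltransl x H `\` A| + #|` ltransl y H `\` A| < #|` H|)%N ->
  (x * h * y^-1)%g \in A ** A^-1s.
Proof.
move=> gH hH ltH.
pose missed (z : gT) := [fset k in H | (z * k)%g \notin A].
have card_missed z u : (u^-1 * z)%g \in H ->
    (#|` missed z| <= #|` ltransl u H `\` A|)%N.
  move=> uzH; rewrite -(card_ltransl z); apply/fsubset_leq_card/fsubsetP => v.
  rewrite in_ltransl in_fsetD in_ltransl !inE /= mulVKg => /andP[zvH ->] /=.
  have -> : (u^-1 * v)%g = ((u^-1 * z) * (z^-1 * v))%g.
    by rewrite -mulgA mulVKg.
  exact: fsubgroupM.
have [/eqP|] := eqVneq (H `\` (missed (x * h)%g `|` missed y)) fset0.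
  rewrite fsetD_eq0 => /fsubset_leq_card.
  have := cardfsUI (missed (x * h)%g) (missed y).
  have := card_missed (x * h)%g x; rewrite mulKg => /(_ hH).
  have := card_missed y y; rewrite mulVg => /(_ gH.1).
  by move: ltH; lia.
move=> /fset0Pn[k]; rewrite in_fsetD in_fsetU negb_or !inE /= => /andP[].
move=> /andP[xk yk] kH; move: xk yk; rewrite kH /= !negbK => xkA ykA.
have -> : (x * h * y^-1)%g = ((x * h * k) * (y * k)^-1)%g.
  by rewrite invgM !mulgA mulgK.
by rewrite mem_mulfs // in_invfs invgK.
Qed.

Lemma card_invfs (gT : groupType) (X : {fset gT}) : #|` X^-1s| = #|` X|.
Proof. by rewrite card_imfset //; exact: invg_inj. Qed.

Lemma invfs_mul (gT : groupType) (X Y : {fset gT}) :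
  (X ** Y)^-1s = Y^-1s ** X^-1s.
Proof.
apply/fsetP => z; rewrite in_invfs; apply/in_mulfs/in_mulfs.
  move=> [x [y [xX yY zxy]]]; exists (y^-1)%g, (x^-1)%g.
  by rewrite !in_invfs !invgK -invgM -zxy invgK.
move=> [y [x [yY xX ->]]]; exists (x^-1)%g, (y^-1)%g.
by rewrite -!in_invfs invgM.
Qed.

Lemma fsubgroup_invfs (gT : groupType) (H : {fset gT}) :
  fsubgroup H -> H^-1s = H.
Proof.
move=> gH; apply/fsetP => x; rewrite in_invfs; apply/idP/idP.
  by move=> /(fsubgroupV gH); rewrite invgK.
exact: fsubgroupV.
Qed.

Lemma mem_lcoset (gT : groupType) (H : {fset gT}) (a x : gT) :
  (x \in [fset a] ** H) = ((a^-1 * x)%g \in H).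
Proof.
apply/in_mulfs/idP => [[b [h [/fset1P-> hH ->]]]|axH]; first by rewrite mulKg.
by exists a, (a^-1 * x)%g; rewrite inE mulVKg.
Qed.

Lemma quotient_cover (gT : groupType) (A H : {fset gT}) (a0 : gT) :
  a0 \in A -> fsubgroup H -> (#|` A ** H| + 2 <= #|` A| + #|` H|)%N ->
  exists2 a, a \in A & forall x y h, x \in A -> y \in A -> h \in H ->
    ~ (x \in [fset a] ** H /\ y \in [fset a] ** H) ->
    (x * h * y^-1)%g \in A ** A^-1s.
Proof.
move=> a0A gH leH.
have [||a [aA maxa]] := exists_argmax (P := fun x => x \in A)
    (f := fun x => #|` ltransl x H `\` A|) (m := #|` H|) (x0 := a0).
- by move=> x _; rewrite -(card_ltransl x H) fsubset_leq_card ?fsubsetDl.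
- by [].
exists a => // x y h xA yA hH; rewrite !mem_lcoset => naxy.
apply: (mem_quotient gH hH).
(* Distinct cosets are handled by [deficit_disjoint] directly. For a common coset other than [a H],
   its deficit is counted twice; the maximality of [a] replaces one copy by the deficit of [a H]. *)
have [xyH|xyH] := boolP ((x^-1 * y)%g \in H); last first.
  by have := deficit_disjoint gH xA yA xyH; move: leH; clear; lia.
have axH : (a^-1 * x)%g \notin H.
  apply/negP => axH; apply: naxy; split=> //.
  by rewrite -(mulVKg x y) mulgA; exact: fsubgroupM.
have := deficit_disjoint gH aA xA axH; have := maxa _ xA.
by rewrite -(ltransl_eq gH xyH); move: leH; clear; lia.
Qed.

(** Outside the conjugate [Q = a H a^-1], of size [|H|], all of [A H A^-1] lies in [A A^-1];
    moreover [|H A^-1| = |A H|] by inversion. *)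
Lemma card_quotient_gt (gT : groupType) (A H : {fset gT}) (a : gT) :
  fsubgroup H -> a \in A ->
  (forall x y h, x \in A -> y \in A -> h \in H ->
     ~ (x \in [fset a] ** H /\ y \in [fset a] ** H) ->
     (x * h * y^-1)%g \in A ** A^-1s) ->
  (#|` A ** H| + #|` H ** A^-1s| <= #|` A ** H ** A^-1s| + #|` H|)%N ->
  (#|` A ** H| + #|` A ** H| < #|` A ** A^-1s| + 2 * #|` H|)%N.
Proof.
move=> gH aA cover leT; have [H1 _] := gH.
pose Q := [fset a] ** H ** [fset a^-1%g].
have Q1 : 1%g \in Q.
  by rewrite -(mulgV a) -{1}(mulg1 a) !mem_mulfs ?inE.
have cQ : #|` Q| = #|` H|.
  rewrite card_mulfs1 -[RHS](card_ltransl a); congr #|` _|.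
  by apply/fsetP => x; rewrite mem_lcoset in_ltransl.
(* The element 1 lies in [Q] and in [A A^-1]; this one extra element makes the inequality strict. *)
have sT : 1%g |` (A ** H ** A^-1s `\` Q) `<=` A ** A^-1s.
  apply/fsubsetP => z; rewrite in_fset1U => /orP[/eqP->|].
    by rewrite -(mulgV a) mem_mulfs // in_invfs invgK.
  rewrite in_fsetD => /andP[zQ].
  move=> /in_mulfs[_ [y [/in_mulfs[x [h [xA hH ->]]] yA ezy]]].
  rewrite in_invfs in yA; rewrite ezy -{1}(invgK y); apply: cover => //.
  rewrite !mem_lcoset => -[axH ayH]; have /negP := zQ; apply.
  have -> : z = (a * ((a^-1 * x * h) * (a^-1 * y^-1)^-1) * a^-1)%g.
    by rewrite invgM !invgK !mulgA mulgV mul1g mulgK ezy.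
  rewrite mem_mulfs ?inE // mem_mulfs ?inE //.
  by apply: gH.2 => //; exact: fsubgroupM.
have := fsubset_leq_card sT; rewrite cardfsU1 in_fsetD Q1 /=.
have := cardfsID Q (A ** H ** A^-1s).
have := fsubset_leq_card (fsubsetIr (A ** H ** A^-1s) Q); rewrite cQ.
have -> : #|` A ** H| = #|` H ** A^-1s|.
  by rewrite -(card_invfs (A ** H)) invfs_mul fsubgroup_invfs.
have := leT; rewrite -(card_invfs (A ** H)) invfs_mul fsubgroup_invfs //.
move: #|` H ** A^-1s| #|` _ `&` Q| #|` _ `\` Q| #|` A ** H ** A^-1s|.
by move: #|` A ** A^-1s| #|` H|; clear; lia.
Qed.

(** * Alternative (ii) for an atom inside the generated subgroup *)

Local Open Scope classical_set_scope.

(* H ranges over finite subgroups, so that the cardinalities involving H make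
   sense. The strict inequalities u > v + w - 2h are written
   v + w < u + 2h, avoiding truncated subtraction; likewise
   |A^-1 A| <= 2|A| - 2 is written |A^-1 A| + 2 <= 2|A|. *)
Theorem corollary3p2 (G0 : groupType) (A : {fset G0}) (G : set G0)
    (defG : G = generated [set` A^-1s ** A])
    (small_AVA : (#|` A^-1s ** A| + 2 <= 2 * #|` A|)%N)
    (AVA_neq_G : [set` A^-1s ** A] <> G) :
  exists (a : G0) (H : {fset G0}),
    [/\ a \in A, is_subgroup [set` H], [set` H] `<=` G, H <> [fset 1%g] &
      (* (i) *)
      ((forall x y : G0, x \in A -> y \in A ->
          ~ (x \in H ** [fset a] /\ y \in H ** [fset a]) ->
          [fset (x^-1)%g] ** H ** [fset y] `<=` A^-1s ** A)%fset
       /\ (#|` A^-1s ** H| + #|` H ** A|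
             < #|` A^-1s ** A| + 2 * #|` H|)%N)
      \/
      (* (ii) *)
      ((forall x y : G0, x \in A -> y \in A ->
          ~ (x \in [fset a] ** H /\ y \in [fset a] ** H) ->
          [fset x] ** H ** [fset (y^-1)%g] `<=` A ** A^-1s)%fset
       /\ (#|` A ** H| + #|` A ** H|
             < #|` A ** A^-1s| + 2 * #|` H|)%N)].
Proof.
have GP x : G x <-> forall M : set G0,
    is_subgroup M -> [set` A^-1s ** A] `<=` M -> M x.
  rewrite defG /generated /smallest; split=> [Gx M gM sM|GM M [gM sM]].
    by apply: Gx; split.
  exact: GM.
have G1 : G 1%g by apply/GP => M [M1 _] _; exact: set_mem M1.
have GV x y : G x -> G y -> G (x * y^-1)%g.
  move=> /GP Gx /GP Gy; apply/GP => M gM sM; apply: set_mem.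
  by apply: gM.2; apply/mem_set; [exact: Gx | exact: Gy].
have EG x : x \in A^-1s ** A -> G x.
  by move=> xE; apply/GP => M _; apply.
have /fset0Pn[a0 a0A] : A != fset0 by rewrite -cardfs_gt0; lia.
have [H [gH sHG atomH]] := exists_atom a0A G1 GV.
have [H1 _] := gH.
have [F [gF sFE leF]] := small_quotient_stable small_AVA.
have leH : (#|` A ** H| + 2 <= #|` A| + #|` H|)%N.
  have := atomH F; have := card_fsubgroup_gt0 gF.
  rewrite cardfs_gt0 => F0 /(_ F0); have FG x : x \in F -> G x.
    by move=> xF; apply/EG/(fsubsetP sFE).
  by move=> /(_ FG); move: leF; clear; lia.
have [a aA cover] := quotient_cover a0A gH leH.
exists a, H; split=> //.
- exact/fsubgroupP.
(* For [H = 1], [leH] would read [|A| + 2 <= |A| + 1]. *)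
- by move=> eH; move: leH; rewrite eH card_mulfs1 cardfs1; lia.
right; split.
  move=> x y xA yA naxy; apply/fsubsetP => z.
  move=> /in_mulfs[_ [_ [/in_mulfs[_ [h [/fset1P-> hH ->]]] /fset1P-> ->]]].
  exact: cover.
apply: card_quotient_gt gH aA cover _.
(* The factor [a0] moves [H A^-1] into [G], because [A^-1 a0] lies in [A^-1 A], and leaves
   cardinalities unchanged. *)
have := atomH (H ** A^-1s ** [fset a0]); rewrite !mulfsA !card_mulfs1; apply.
  apply/fset0Pn; exists (1 * a0^-1 * a0)%g.
  by rewrite !mem_mulfs ?inE // in_invfs invgK.
move=> _ /in_mulfs[_ [_ [/in_mulfs[h [b [hH bA ->]]] /fset1P-> ->]]].
rewrite -mulgA -(invgK (b * a0)%g); apply: (GV); first exact: sHG.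
rewrite -[((b * a0)^-1)%g]mul1g; apply: GV => //.
by apply: EG; exact: mem_mulfs.
Qed.
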